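(* Let $F_1$ and $F_2$ be different strictly increasing continuous distribution functions on $\mathbb{R}$, and let $p_1$ and $p_2$ be the Borel probability measures on $\mathbb{R}$ defined by $F_1$ and $F_2$, respectively. Then the infinite power measures $p_1^{\mathbb{N}}$ and $p_2^{\mathbb{N}}$ on $\mathbb{R}^{\mathbb{N}}$ are orthogonal.
   Context: $\mathbb{R}^{\mathbb{N}}$ is the space of all real sequences with the product topology and its Borel $\sigma$-algebra. A Borel probability measure $p$ on $\mathbb{R}$ is defined by the distribution function $F$ if $p((-\infty,x])=F(x)$ for all $x\in\mathbb{R}$. $p^{\mathbb{N}}$ denotes the product of countably many copies of $p$. Two measures $\mu,\nu$ on a measurable space $(X,M)$ are called orthogonal if there is $E\in M$ with $\mu(E)=0$ and $\nu(X\setminus E)=0$. *)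

(* Defs.v *)
From mathcomp Require Import all_boot all_order all_algebra.
From mathcomp Require Import all_classical all_reals all_analysis.

Set Implicit Arguments.
Unset Strict Implicit.
Unset Printing Implicit Defensive.

Import Order.TTheory GRing.Theory Num.Theory.
Import numFieldNormedType.Exports.

Local Open Scope classical_set_scope.
Local Open Scope ring_scope.

Definition defined_by (R : realType) (p : probability (measurableTypeR R) R)
    (F : R -> R) : Prop :=
  forall x : R, p [set` `]-oo, x]] = (F x)%:E.

(* The Borel sigma-algebra of the product topology (pointwise convergence). *)
Notation real_sequences R := (g_sigma_algebraType (@open {ptws nat -> R})).

(* mu is the product of countably many copies of p.  Such a mu exists, and it
   is unique because the measurable cylinders form a pi-system that generates
   the Borel sigma-algebra. *)
Definition infinite_power (R : realType) (p : probability (measurableTypeR R) R)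
    (mu : probability (real_sequences R) R) : Prop :=
  forall (n : nat) (A : nat -> set (measurableTypeR R)),
    (forall i, measurable (A i)) ->
    mu [set x : nat -> R | forall i, (i < n)%N -> A i (x i)] =
    (\prod_(i < n) p (A i))%E.

Definition orthogonal_measures (d : measure_display) (X : measurableType d)
    (R : realType) (mu nu : {measure set X -> \bar R}) : Prop :=
  exists E : set X, [/\ measurable E, mu E = 0%E & nu (~` E) = 0%E].

(* Main.v *)
Require Import Defs.
From mathcomp Require Import all_boot all_order all_algebra.
From mathcomp Require Import all_classical all_reals all_analysis.
From mathcomp Require Import ring lra measurable_realfun.

Import Order.TTheory GRing.Theory Num.Theory.
Import numFieldNormedType.Exports.

Local Open Scope classical_set_scope.
Local Open Scope ring_scope.

(** Two different distribution functions differ at some point [x], so the Borel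
    set [A = ]-oo, x]] has different probabilities under the two measures.
    Recording for each of the first [N] coordinates of a sequence whether it
    lies in [A] gives a binary word of length [N], and under the power measures
    this word is a string of [N] independent biased bits, with two different
    biases.  The likelihood-ratio test on such words tells the two measures
    apart with exponentially small error.  Let [P] and [Q] be the two laws of
    the word.  On the set of words where [P w <= Q w] one has
    [P w <= sqrt (P w * Q w)], so both the [P]-mass of this set and the [Q]-mass
    of its complement are at most the Bhattacharyya affinity
    [\sum_w sqrt (P w * Q w)] ([dominated_mass_le_affinity]).  The affinity is
    multiplicative over independent letters ([affinity_word_mass]), hence equal
    to [r ^+ N] where [r] is the affinity of the two laws of a single bit, and
    [r < 1] because these laws differ ([affinity_lt1]).

    The errors are therefore summable, and by the Borel-Cantelli lemma, used
    once for each measure, the set of sequences that pass the test for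
    infinitely many [N] is null for the first measure while its complement is
    null for the second ([orthogonal_of_tests]). *)

(** * Bhattacharyya affinity of finite distributions *)

Definition affinity {R : rcfType} {J : finType} (f g : J -> R) : R :=
  \sum_(j : J) Num.sqrt (f j * g j).

Lemma affinityC {R : rcfType} {J : finType} (f g : J -> R) :
  affinity f g = affinity g f.
Proof. by apply: eq_bigr => j _; rewrite mulrC. Qed.

Lemma affinity_ge0 {R : rcfType} {J : finType} (f g : J -> R) :
  0 <= affinity f g.
Proof. by apply: sumr_ge0 => j _; exact: sqrtr_ge0. Qed.

(** The defect [1 - affinity f g] is half the squared Hellinger distance
    [\sum_j (sqrt (f j) - sqrt (g j)) ^+ 2], which vanishes only if [f] and [g]
    agree. *)
Lemma affinity_lt1 {R : rcfType} {J : finType} (f g : J -> R) :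
  (forall j, 0 <= f j) -> (forall j, 0 <= g j) ->
  \sum_j f j = 1 -> \sum_j g j = 1 ->
  (exists j, f j <> g j) -> affinity f g < 1.
Proof.
move=> f0 g0 sf sg [j fg].
pose h i := (Num.sqrt (f i) - Num.sqrt (g i)) ^+ 2.
have hE i : h i = f i + g i - 2 * Num.sqrt (f i * g i).
  by rewrite /h sqrrB !sqr_sqrtr// sqrtrM// mulr_natl; ring.
have sumh : \sum_i h i = 2 - 2 * affinity f g.
  under eq_bigr do rewrite hE.
  by rewrite big_split/= big_split/= sf sg sumrN -mulr_sumr.
suff : 0 < \sum_i h i by rewrite sumh; lra.
rewrite (bigD1 j)//= ltr_pwDl//; last by apply: sumr_ge0 => i _; exact: sqr_ge0.
rewrite lt_def sqr_ge0 andbT sqrf_eq0 subr_eq0.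
by apply/eqP => /(congr1 (fun x => x ^+ 2)); rewrite !sqr_sqrtr.
Qed.

(** Where [f j <= g j], the geometric mean of [f j] and [g j] is at least
    [f j]. *)
Lemma dominated_mass_le_affinity {R : rcfType} {J : finType} (f g : J -> R) :
  (forall j, 0 <= f j) -> \sum_(j | f j <= g j) f j <= affinity f g.
Proof.
move=> f0; rewrite big_mkcond/=; apply: ler_sum => j _.
case: ifPn => [fg|_]; last exact: sqrtr_ge0.
rewrite -[leLHS]ger0_norm// -sqrtr_sqr expr2 ler_sqrt ?ler_wpM2l//.
by rewrite mulr_ge0// (le_trans (f0 j)).
Qed.

Definition word_mass {R : pzSemiRingType} {J : finType} (f : J -> R) {N}
    (w : {ffun 'I_N -> J}) : R := \prod_(i < N) f (w i).

(** Expanding the [N]-th power of the one-letter sum gives one product for each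
    word, and the square root commutes with products of nonnegative numbers. *)
Lemma affinity_word_mass {R : rcfType} {J : finType} (f g : J -> R) N :
  (forall j, 0 <= f j) -> (forall j, 0 <= g j) ->
  affinity (word_mass f (N := N)) (word_mass g (N := N)) = affinity f g ^+ N.
Proof.
move=> f0 g0; rewrite -[in RHS](card_ord N) -prodr_const.
rewrite /affinity (bigA_distr_bigA (fun=> fun j => Num.sqrt (f j * g j))).
apply: eq_bigr => w _; rewrite /word_mass -big_split/=.
elim/big_rec2: _ => [|i x y _ <-]; first by rewrite sqrtr1.
by rewrite [LHS]sqrtrM ?mulr_ge0.
Qed.

(** * Orthogonality from tests with geometrically small errors *)

Lemma geometric_summable {R : realType} {r : R} : 0 <= r < 1 ->
  (\sum_(0 <= n <oo) (r ^+ n)%:E < +oo)%E.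
Proof.
move=> /andP[r0 r1].
have : (fun n => \sum_(0 <= k < n) (r ^+ k)%:E)%E @ \oo --> (1 / (1 - r))%:E.
  under eq_fun do rewrite sumEFin.
  apply/fine_cvgP; split; first by near=> n.
  have := @cvg_geometric_series R 1 r; rewrite ger0_norm// => /(_ r1).
  apply: cvg_trans; apply: near_eq_cvg; near=> n => /=.
  by rewrite /series/=; apply: eq_bigr => i _; rewrite mul1r.
by move/cvg_lim => -> //; rewrite ltry.
Unshelve. all: by end_near. Qed.

Lemma Borel_Cantelli_geometric {d} {X : measurableType d} {R : realType}
    {mu : {measure set X -> \bar R}} {r : R} {E : nat -> set X} :
  0 <= r < 1 -> (forall n, measurable (E n)) ->
  (forall n, mu (E n) <= (r ^+ n)%:E)%E -> mu (lim_sup_set E) = 0%E.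
Proof.
move=> r01 mE muE; apply: lim_sup_set_cvg0 => //.
apply: le_lt_trans _ (geometric_summable r01).
by apply: lee_nneseries.
Qed.

(** The separating set is the upper limit of the [E n].  Its complement is the
    lower limit of the complements [~` E n], which is contained in their upper
    limit, so the Borel-Cantelli lemma handles both measures. *)
Lemma orthogonal_of_tests {d} {X : measurableType d} {R : realType}
    {mu nu : {measure set X -> \bar R}} (r : R) (E : nat -> set X) :
  0 <= r < 1 -> (forall n, measurable (E n)) ->
  (forall n, mu (E n) <= (r ^+ n)%:E)%E ->
  (forall n, nu (~` E n) <= (r ^+ n)%:E)%E ->
  orthogonal_measures mu nu.
Proof.
move=> r01 mE muE nuE.
have mlim (F : nat -> set X) :
    (forall n, measurable (F n)) -> measurable (lim_sup_set F).
  by move=> mF; apply: bigcapT_measurable => n; exact: bigcup_measurable.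
have mEC n : measurable (~` E n) by exact: measurableC.
exists (lim_sup_set E); split; [exact: mlim | |].
  exact: Borel_Cantelli_geometric muE.
apply: (subset_measure0 _ _ _ (Borel_Cantelli_geometric r01 mEC nuE)).
- by apply: measurableC; exact: mlim.
- exact: mlim.
rewrite /lim_sup_set setC_bigcap => x [n _].
rewrite setC_bigcup => xn m _; exists (maxn n m); first by rewrite /= leq_maxr.
by apply: xn; rewrite /= leq_maxl.
Qed.

(** * Binary coding of sequences *)

Definition letter {T} (A : set T) (b : bool) : set T := if b then A else ~` A.

Definition coding {T} (A : set T) N (x : nat -> T) : {ffun 'I_N -> bool} :=
  [ffun i : 'I_N => x i \in A].

Lemma letterP {T} (A : set T) b t : letter A b t <-> (t \in A) = b.
Proof.
case: b => /=; split.
- by move/mem_set.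
- by move/set_mem.
- by move=> nA; apply/negbTE/negP => /set_mem.
- by move=> /negP nA /mem_set.
Qed.

Lemma coding_fiberE {T} (A : set T) N w :
  coding A N @^-1` [set w] = [set x | forall i : 'I_N, letter A (w i) (x i)].
Proof.
apply/seteqP; split => x /=.
  by move=> <- i; rewrite ffunE; apply/letterP.
by move=> h; apply/ffunP => i; rewrite ffunE; exact/letterP.
Qed.

Lemma coding_preimageE {T} (A : set T) N (D : pred {ffun 'I_N -> bool}) :
  [set x | D (coding A N x)] =
  \bigcup_(w in [set` D]) (coding A N @^-1` [set w]).
Proof.
apply/seteqP; split => x /=; first by move=> Dx; exists (coding A N x).
by move=> [w /= Dw xw]; rewrite xw.
Qed.

Definition letter_mass {R : realType} (p : probability (measurableTypeR R) R)
  (A : set R) (b : bool) : R := fine (p (letter A b)).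

Section coding_law.
Context {R : realType}.
Implicit Types (A : set (measurableTypeR R)).
Implicit Types (p q : probability (measurableTypeR R) R).
Implicit Types (mu nu : probability (real_sequences R) R).

Lemma measurable_letter {A} b : measurable A ->
  measurable (letter A b : set (measurableTypeR R)).
Proof. by case: b => //= mA; exact: measurableC. Qed.

Lemma letter_mass_ge0 p A b : 0 <= letter_mass p A b.
Proof. by rewrite fine_ge0. Qed.

Lemma letter_mass_sum p A : measurable A -> \sum_b letter_mass p A b = 1.
Proof.
move=> mA; rewrite big_bool/= /letter_mass/= probability_setC//.
by rewrite fineB ?fin_num_measure//= addrC subrK.
Qed.

(** Evaluation at an index is continuous for the product topology, and open
    intervals generate the Borel sets of the line. *)
Lemma measurable_coordinate (i : nat) :
  measurable_fun setT (fun x : real_sequences R => (x i : measurableTypeR R)).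
Proof.
apply: (measurability _ (RGenOpens.measurableE R)).
move=> _ [_ [a [b ->] <-]]; rewrite setTI; apply: sub_sigma_algebra.
have /continuousP cont : continuous (fun x : {ptws nat -> R} => x i) :=
  @proj_continuous nat (fun=> R) i.
by apply: cont; exact: interval_open.
Qed.

Lemma measurable_coding_fiber A N w : measurable A ->
  measurable (coding A N @^-1` [set w] : set (real_sequences R)).
Proof.
move=> mA; rewrite coding_fiberE.
rewrite (_ : mkset _ =
    \bigcap_(i in [set: 'I_N]) [set x | letter A (w i) (x i)]); last first.
  by apply/seteqP; split => x /= h i; [move=> _|]; exact: h.
apply: fin_bigcap_measurable => // i _.
rewrite -[X in measurable X]setTI.
by apply: (measurable_coordinate i) => //; exact: measurable_letter.
Qed.

Lemma measure_coding_fiber A N w p mu : measurable A -> infinite_power p mu ->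
  mu (coding A N @^-1` [set w]) = (word_mass (letter_mass p A) w)%:E.
Proof.
move=> mA pmu.
(* the word w, continued by the full line beyond its length, as a sequence of
   constraints on the coordinates *)
pose B (i : nat) := if insub i is Some j then letter A (w j) else setT.
have Bi (i : 'I_N) : B i = letter A (w i) by rewrite /B valK.
have mB i : measurable (B i : set (measurableTypeR R)).
  by rewrite /B; case: insub => // j; exact: measurable_letter.
rewrite /word_mass -prodEFin coding_fiberE.
transitivity (mu [set x : nat -> R | forall i, (i < N)%N -> B i (x i)]).
  congr (mu _); apply/seteqP; split => x /= h i.
    by move=> iN; rewrite -[i]/(val (Ordinal iN)) Bi.
  by rewrite -Bi; exact: h.
rewrite pmu//; apply: eq_bigr => i _.
by rewrite Bi /letter_mass fineK// fin_num_measure//; exact: measurable_letter.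
Qed.

Lemma measurable_coding A N (D : pred {ffun 'I_N -> bool}) : measurable A ->
  measurable ([set x | D (coding A N x)] : set (real_sequences R)).
Proof.
move=> mA; rewrite coding_preimageE; apply: fin_bigcup_measurable => // w _.
exact: measurable_coding_fiber.
Qed.

(** Under a power measure the code of a sequence is a string of independent
    letters: an event on words has the sum of its word masses as measure. *)
Lemma measure_coding A p mu N (D : pred {ffun 'I_N -> bool}) :
  measurable A -> infinite_power p mu ->
  mu [set x | D (coding A N x)] =
  (\sum_(w | D w) word_mass (letter_mass p A) w)%:E.
Proof.
move=> mA pmu; rewrite coding_preimageE measure_fin_bigcup//.
- rewrite (_ : [set` D] = [set` enum D]); last first.
    by apply/seteqP; split => w; rewrite /= mem_enum.
  rewrite -fsbig_seq ?enum_uniq// big_enum/= -sumEFin.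
  by apply: eq_bigr => w _; rewrite (measure_coding_fiber _ _ w p).
- apply/trivIsetP => v w _ _ /eqP vw; apply/seteqP; split => // x [/= xv xw].
  by apply: vw; rewrite -xv.
- by move=> w _; exact: measurable_coding_fiber.
Qed.

(** * Orthogonality of infinite powers *)

(** The tests are the likelihood-ratio tests on the codes of length [N]: a
    sequence passes when its code is at least as likely under [q] as under
    [p]. *)
Lemma orthogonal_powers {p q mu nu A} : measurable A -> p A <> q A ->
  infinite_power p mu -> infinite_power q nu -> orthogonal_measures mu nu.
Proof.
move=> mA pqA pmu qnu.
pose f := letter_mass p A; pose g := letter_mass q A.
have f0 b : 0 <= f b by exact: letter_mass_ge0.
have g0 b : 0 <= g b by exact: letter_mass_ge0.
have fg : exists b, f b <> g b.
  exists true => fg; apply: pqA.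
  rewrite -[LHS]fineK ?fin_num_measure// -[RHS]fineK ?fin_num_measure//.
  by congr EFin.
have F0 N (w : {ffun 'I_N -> bool}) : 0 <= word_mass f w by apply: prodr_ge0.
have G0 N (w : {ffun 'I_N -> bool}) : 0 <= word_mass g w by apply: prodr_ge0.
pose D N : pred {ffun 'I_N -> bool} := fun w => word_mass f w <= word_mass g w.
apply: (orthogonal_of_tests (affinity f g)
  (fun N => [set x : real_sequences R | D N (coding A N x)])) => [|N|N|N].
- by rewrite affinity_ge0 affinity_lt1// letter_mass_sum.
- exact: measurable_coding.
- rewrite [leLHS](measure_coding A p mu N (D N) mA pmu) lee_fin.
  by rewrite -affinity_word_mass//; exact: dominated_mass_le_affinity.
- rewrite (_ : ~` _ = [set x | predC (D N) (coding A N x)]); last first.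
    by apply/seteqP; split => x /= /negP.
  rewrite [leLHS](measure_coding A q nu N _ mA qnu) lee_fin.
  rewrite -affinity_word_mass// affinityC.
  (* words failing the test are those with word_mass g w < word_mass f w *)
  apply: le_trans (dominated_mass_le_affinity _ _ (G0 N)).
  rewrite [leRHS]big_mkcond [leLHS]big_mkcond/=; apply: ler_sum => w _.
  by rewrite /D -ltNge; case: ltP => [/ltW ->|] //; case: ifP => // _ _; exact: G0.
Qed.

End coding_law.

(* cumulativeBounded 0 1 is the type of distribution functions: nondecreasing,
   right-continuous, with limits 0 at -oo and 1 at +oo. *)
Theorem theorem4p10 (R : realType) (F1 F2 : cumulativeBounded (0 : R) (1 : R))
    (p1 p2 : probability (measurableTypeR R) R)
    (mu1 mu2 : probability (real_sequences R) R) :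
  {homo F1 : x y / x < y} -> {homo F2 : x y / x < y} ->
  continuous F1 -> continuous F2 ->
  (F1 : R -> R) <> (F2 : R -> R) ->
  defined_by p1 F1 -> defined_by p2 F2 ->
  infinite_power p1 mu1 -> infinite_power p2 mu2 ->
  orthogonal_measures mu1 mu2.
Proof.
move=> _ _ _ _ F12 pF1 pF2 pmu1 pmu2.
have [x Fx] : exists x, F1 x <> F2 x.
  by apply/existsNP => F12x; apply: F12; apply/funext.
apply: (orthogonal_powers (measurable_itv `]-oo, x]) _ pmu1 pmu2).
by rewrite pF1 pF2 => -[].
Qed.
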